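(* Let $\Pi=(P,\mathcal{L})$ and $\Pi'=(P',\mathcal{L}')$ be $n$-dimensional linear spaces, $n\ge 4$, both satisfying the exchange axiom and the axiom (P2), and let $k\ge 0$ be an integer with $n>2k+1$. Let $f$ be a bijection of $\mathcal{G}_{k}(\Pi)$ to $\mathcal{G}_{k}(\Pi')$ such that both $f$ and $f^{-1}$ send base subsets to base subsets. Then there is a collineation $g$ of $\Pi$ to $\Pi'$ with $f(S)=g(S)$ for all $S\in\mathcal{G}_k(\Pi)$.
   Context: A linear space $\Pi=(P,\mathcal{L})$ is a set $P$ of points with a family $\mathcal{L}$ of proper subsets (lines) such that each line has at least two points and any two distinct points $p,q$ lie on exactly one line $pq$. A subspace is a set $S\subset P$ with $pq\subset S$ for all distinct $p,q\in S$; $\overline{X}$ is the smallest subspace containing $X$. A set $X$ is independent if $\overline{X}$ is not spanned by a proper subset of $X$; a base of a subspace $S$ is an independent set spanning $S$. A subspace is $m$-dimensional if $m+1$ is the smallest number of points spanning it. Exchange axiom: for every $X\subset P$ and $p_1,p_2\in P\setminus\overline{X}$, $p_2\in\overline{X\cup\{p_1\}}$ implies $p_1\in\overline{X\cup\{p_2\}}$. Axiom (P2): every line contains at least three points. $\mathcal{G}_k(\Pi)$ is the set of $k$-dimensional subspaces. For a base $B$ of $\Pi$, the base subset of $\mathcal{G}_k(\Pi)$ associated with $B$ is the set of all $k$-dimensional subspaces spanned by points of $B$. A collineation of $\Pi$ to $\Pi'$ is a bijection $g:P\to P'$ with $g(\mathcal{L})=\mathcal{L}'$. *)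

(* Defs.v *)
From mathcomp Require Import all_boot.
From mathcomp Require Import boolp classical_sets functions.
Set Implicit Arguments. Unset Strict Implicit. Unset Printing Implicit Defensive.
Local Open Scope classical_set_scope.

Section LinearSpaces.
Variable P : Type.
Variable L : set (set P).

Definition linear_space : Prop :=
  [/\ (forall l, L l -> l <> setT),
      (forall l, L l -> exists p q, [/\ l p, l q & p <> q]) &
      (forall p q, p <> q -> exists l, [/\ L l, l p, l q &
          forall l', L l' -> l' p -> l' q -> l' = l])].

Definition subspace (S : set P) : Prop :=
  forall p q l, S p -> S q -> p <> q -> L l -> l p -> l q -> l `<=` S.

Definition closure (X : set P) : set P :=
  [set x | forall S, subspace S -> X `<=` S -> S x].

Definition independent (X : set P) : Prop :=
  ~ (exists Y, Y `<` X /\ closure Y = closure X).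

Definition base_of (S B : set P) : Prop := independent B /\ closure B = S.

Definition base (B : set P) : Prop := base_of setT B.

Definition is_dim (m : nat) (S : set P) : Prop :=
  [/\ subspace S,
      (exists h : 'I_m.+1 -> P, closure (range h) = S) &
      (forall j (h : 'I_j -> P), closure (range h) = S -> m.+1 <= j)].

Definition Grass (k : nat) : set (set P) := [set S | is_dim k S].

Definition base_subset (k : nat) (B : set P) : set (set P) :=
  [set S | Grass k S /\ exists Y, Y `<=` B /\ closure Y = S].

Definition exchange_axiom : Prop :=
  forall (X : set P) (p1 p2 : P), ~ closure X p1 -> ~ closure X p2 ->
    closure (X `|` [set p1]) p2 -> closure (X `|` [set p2]) p1.

Definition axiom_P2 : Prop :=
  forall l, L l -> exists p q r, [/\ l p, l q, l r & [/\ p <> q, q <> r & p <> r]].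

End LinearSpaces.

Definition collineation (P P' : Type) (L : set (set P)) (L' : set (set P'))
  (g : P -> P') : Prop :=
  bijective g /\ [set g @` l | l in L] = L'.

(* Main.v *)
Require Import Defs.
From mathcomp Require Import all_boot zify.
Set Implicit Arguments. Unset Strict Implicit. Unset Printing Implicit Defensive.

(* Index a base B by 'I_n.+1, so that its base subset becomes the set of
   (k+1)-subsets of the index set, and let C_ij be the family of those containing i
   but not j. A family of (k+1)-subsets that meets every C_ij determines the base,
   because each point of B is then an intersection of spanned subspaces; the
   complement of C_ij does not, because b_i can be slid along the line b_i b_j
   (this is where three points on a line are needed). Hence f permutes the families
   C_ij, and since n > 2k+1 the size of C_ij :&: C_i'j' reveals whether i = i'; so
   on each base subset f is induced by a bijection of bases. Two bases sharing all
   but one point give the same image to a common point p, because p is cut out by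
   two k-dimensional subspaces spanned by common points; as bases through p are
   connected by such exchanges, the bijections of bases glue to a map of points. It
   preserves independence in both directions, hence closures of independent sets. *)

(** * Counting families of finite sets of size [k.+1] *)

Section Comb.
Variable (T : finType).
Implicit Types (A D Y : {set T}).

(** Taking the union with [A] maps the [m]-subsets of the complement of [A :|: D] bijectively onto
    the sets counted. *)
Lemma card_between A D m : [disjoint A & D] ->
  #|[set Y : {set T} | [&& A \subset Y, [disjoint Y & D] & #|Y| == m + #|A|]]| =
    'C(#|T| - (#|A| + #|D|), m).
Proof.
move=> dAD.
have <- : #|~: (A :|: D)| = #|T| - (#|A| + #|D|).
  rewrite cardsCs setCK cardsU; move: dAD; rewrite -setI_eq0 => /eqP ->.
  by rewrite cards0 subn0.
rewrite -cards_draws.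
rewrite -[RHS](card_in_imset (f := fun Y => A :|: Y)); last first.
  move=> Y Z; rewrite !inE => /andP[/subsetP YA _] /andP[/subsetP ZA _] /setP E.
  apply/setP => x; have := E x; have := YA x; have := ZA x; rewrite !inE.
  by case: (x \in A) => //= zA yA _; apply/idP/idP => [/yA|/zA].
apply: eq_card => Y; rewrite !inE; apply/idP/idP => [/and3P[AY dYD /eqP cY]|].
  apply/imsetP; exists (Y :\: A); last first.
    by apply/setP => x; rewrite !inE; case: (boolP (x \in A)) => //= /(subsetP AY) ->.
  rewrite inE; apply/andP; split.
    apply/subsetP => x; rewrite !inE => /andP[xA xY]; rewrite (negPf xA) /=.
    by rewrite (disjointFr dYD xY).
  by rewrite cardsD (setIidPr AY) cY addnK.
move=> /imsetP[Z]; rewrite inE => /andP[/subsetP ZAD /eqP cZ] ->.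
rewrite subsetUl /=; apply/andP; split.
  rewrite disjoint_sym disjoint_subset; apply/subsetP => x xD; rewrite !inE.
  rewrite (disjointFl dAD xD) /=; apply: contraL xD => /ZAD.
  by rewrite !inE => /norP[].
rewrite cardsU (_ : A :&: Z = set0) ?cards0 ?subn0 ?cZ 1?addnC//.
apply/setP => x; rewrite !inE; apply/negP => /andP[xA /ZAD]; rewrite !inE xA //.
Qed.

Lemma disjoints2 a b Y : [disjoint [set a; b] & Y] = (a \notin Y) && (b \notin Y).
Proof. by rewrite -[Y]setCK -subsets_disjoint subUset !sub1set !inE !negbK. Qed.

Lemma ex_between A D m : [disjoint A & D] -> m + #|A| + #|D| <= #|T| ->
  exists Y, [/\ A \subset Y, [disjoint Y & D] & #|Y| = m + #|A|].
Proof.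
move=> dAD le.
suff /card_gt0P[Y] :
  0 < #|[set Y : {set T} | [&& A \subset Y, [disjoint Y & D] & #|Y| == m + #|A|]]|.
  by rewrite inE => /and3P[? ? /eqP]; exists Y.
by rewrite card_between// bin_gt0; lia.
Qed.

Variable k : nat.

(** These are the families C_ij of the overview. *)
Definition sep i j := [set Y : {set T} | [&& i \in Y, j \notin Y & #|Y| == k.+1]].

Lemma card_sep i j : i != j -> #|sep i j| = 'C(#|T| - 2, k).
Proof.
move=> ij; have dij : [disjoint [set i] & [set j]] by rewrite disjoints1 inE.
rewrite -[2]/(1 + 1) -{1}(cards1 i) -(cards1 j) -(card_between _ dij).
by apply: eq_card => Y; rewrite !inE sub1set disjoint_sym disjoints1 cards1 addn1.
Qed.

Lemma card_sepIl i j j' : i != j -> i != j' -> j != j' ->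
  #|sep i j :&: sep i j'| = 'C(#|T| - 3, k).
Proof.
move=> ij ij' jj'; have dij : [disjoint [set i] & [set j; j']].
  by rewrite disjoints1 !inE negb_or ij.
rewrite -[3]/(1 + 2) -{1}(cards1 i).
have <- : #|[set j; j']| = 2 by rewrite cards2 jj'.
rewrite -(card_between _ dij); apply: eq_card => Y; rewrite !inE sub1set cards1 addn1.
rewrite disjoint_sym disjoints2; case: (i \in Y) => //=.
by case: (j \in Y); case: (j' \in Y); case: (_ == _).
Qed.

(** Members contain [i] and [i'] and avoid [j], so there are at most ['C(#|T| - 3, k.-1)] of them;
    this is smaller because the binomial coefficients still grow from [k.-1] to [k] when 2k + 2 <
    |T|. For [j = i'] or [k = 0] the intersection is empty. *)
Lemma card_sepI_lt i i' j j' : i != i' -> i != j -> 2 * k + 2 < #|T| ->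
  #|sep i j :&: sep i' j'| < 'C(#|T| - 3, k).
Proof.
move=> ii' ij lek.
have C0 : 0 < 'C(#|T| - 3, k) by rewrite bin_gt0; lia.
have [->|i'j] := eqVneq j i'.
  rewrite (_ : _ :&: _ = set0) ?cards0//; apply/setP => Y; rewrite !inE.
  by case: (i' \in Y); rewrite ?andbF.
have c2 : #|[set i; i']| = 2 by rewrite cards2 ii'.
have [k0|k_gt0] := posnP k.
  rewrite (_ : _ :&: _ = set0) ?cards0//; apply/setP => Y; rewrite !inE.
  apply/negP => /andP[/and3P[iY _ /eqP c1] /and3P[i'Y _ _]].
  have /subset_leq_card : [set i; i'] \subset Y by rewrite subUset !sub1set iY.
  by rewrite c2 c1 k0.
have dij : [disjoint [set i; i'] & [set j]].
  by rewrite disjoint_sym disjoints1 !inE negb_or eq_sym ij i'j.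
apply: (@leq_ltn_trans 'C(#|T| - 3, k.-1)).
  rewrite -[3]/(2 + 1) -{1}c2 -(cards1 j) -(card_between _ dij) subset_leq_card//.
  apply/subsetP => Y; rewrite !inE => /andP[/and3P[iY jY /eqP c1] /and3P[i'Y _ _]].
  by rewrite subUset !sub1set iY i'Y disjoint_sym disjoints1 jY c1 c2 /=; lia.
have := mul_bin_left (#|T| - 3) k.-1; rewrite prednK//; nia.
Qed.

(* The images of the sets [sep i j] determine a point [sigma i]: among the
   pairs of such sets, those with a common first index have the largest intersection. *)
Lemma sep_perm (phi : {set T} -> {set T}) : 2 * k + 2 < #|T| ->
  (forall Y, #|Y| = k.+1 -> #|phi Y| = k.+1) ->
  {in [pred Y : {set T} | #|Y| == k.+1] &, injective phi} ->
  (forall i j, i != j -> exists i' j', i' != j' /\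
     forall Y, #|Y| = k.+1 -> i' \in phi Y -> j' \notin phi Y -> (i \in Y) && (j \notin Y)) ->
  exists2 sigma : T -> T, injective sigma &
    forall Y, #|Y| = k.+1 -> phi Y = sigma @: Y.
Proof.
move=> ltkT phiK phi_inj phi_sep.
have phi_onto (Z : {set T}) : #|Z| = k.+1 -> exists2 Y : {set T}, #|Y| = k.+1 & phi Y = Z.
  move=> cZ; pose K := [set Y : {set T} | #|Y| == k.+1].
  have KK : phi @: K = K.
    apply/eqP; rewrite eqEcard card_in_imset ?leqnn ?andbT; last first.
      by move=> Y Y'; rewrite !inE => YK Y'K; apply: phi_inj; rewrite inE.
    by apply/subsetP => _ /imsetP[Y + ->]; rewrite !inE => /eqP/phiK ->.
  have : Z \in phi @: K by rewrite KK inE cZ.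
  by case/imsetP => Y; rewrite inE => /eqP cY ->; exists Y.
(* [sep i' j'] lies in the image of [sep i j], and both have ['C(#|T| - 2, k)] members. *)
have sepE i j : i != j -> exists i' j', i' != j' /\ phi @: sep i j = sep i' j'.
  move=> ij; have [i' [j' [ij' sepij]]] := phi_sep i j ij.
  exists i', j'; split=> //; apply/esym/eqP; rewrite eqEcard; apply/andP; split.
    apply/subsetP => Z; rewrite inE => /and3P[iZ jZ /eqP/phi_onto[Y cY YZ]].
    rewrite -YZ; apply: imset_f; rewrite -YZ in iZ jZ.
    by rewrite inE cY eqxx andbT sepij.
  rewrite card_in_imset ?card_sep// => Y Y'.
  rewrite !inE => /and3P[_ _ YK] /and3P[_ _ Y'K]; apply: phi_inj; rewrite inE//.
have phiI (A B : {set {set T}}) : {in A, forall Y, #|Y| = k.+1} ->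
    {in B, forall Y, #|Y| = k.+1} -> phi @: (A :&: B) = phi @: A :&: phi @: B.
  move=> AK BK; apply: imsetI => Y Y' /AK YK /BK Y'K; apply: phi_inj; rewrite inE ?YK ?Y'K//.
have sepK i j : {in sep i j, forall Y, #|Y| = k.+1} by move=> Y; rewrite inE => /and3P[_ _ /eqP].
have cardI i j i' j' : #|phi @: sep i j :&: phi @: sep i' j'| = #|sep i j :&: sep i' j'|.
  rewrite -phiI; try exact: sepK.
  rewrite card_in_imset// => Y Y'; rewrite !inE.
  by move=> /andP[/and3P[_ _ YK] _] /andP[/and3P[_ _ Y'K] _]; apply: phi_inj; rewrite inE.
have neq (i : T) : exists j, i != j.
  have /card_gt0P[j] : 0 < #|predC1 i| by rewrite cardC1; lia.
  by rewrite inE eq_sym; exists j.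
have [] := @fin_all_exists _ _ (fun i s => forall j, i != j ->
    exists2 t, s != t & phi @: sep i j = sep s t).
  (* The first index found for one fixed [j0] serves every [j]: a different one would make the
     intersection of the images too small. *)
  move=> i; have [j0 ij0] := neq i; have [s [t0 [st0 E0]]] := sepE _ _ ij0.
  exists s => j ij; have [<-|j0j] := eqVneq j0 j; first by exists t0.
  have [s' [t [st E]]] := sepE _ _ ij.
  suff ss' : s = s' by rewrite ss'; exists t.
  apply/eqP; apply: contraT => ss'.
  have := card_sepI_lt t ss' st0 ltkT.
  by rewrite -E0 -E cardI card_sepIl// ltnn.
move=> sigma sigmaP.
have sigma_inj : injective sigma.
  move=> i l E; apply/eqP; apply: contraT => il.
  have [t st Et] := sigmaP _ _ il.
  have li : l != i by rewrite eq_sym.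
  have [u su Eu] := sigmaP _ _ li.
  (* [sep i l] and [sep l i] are disjoint, while their images share the first index [sigma i] and
     therefore meet. *)
  have : #|sep i l :&: sep l i| = 0.
    apply/eqP; rewrite cards_eq0; apply/eqP/setP => Y; rewrite !inE.
    by case: (i \in Y); rewrite ?andbF.
  rewrite -cardI Et Eu -E => /eqP; rewrite cards_eq0 => /eqP/setP S0.
  have [||Y [sY]] := @ex_between [set sigma i] [set t; u] k.
  - by rewrite disjoints1 !inE negb_or st E.
  - by rewrite cards1 cards2; have := leq_b1 (t != u); lia.
  rewrite disjoint_sym disjoints2 => /andP[tY uY]; rewrite cards1 addn1 => cY.
  by have := S0 Y; rewrite !inE -sub1set sY tY uY cY eqxx.
exists sigma => // Y cY; apply/esym/eqP.
rewrite eqEcard card_imset// phiK// cY leqnn andbT.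
apply/subsetP => _ /imsetP[i iY ->].
(* Any [j] outside [Y] puts [Y] in [sep i j], whose image consists of sets containing [sigma i]. *)
have [j jY] : exists j, j \notin Y.
  have /card_gt0P[j] : 0 < #|~: Y| by rewrite cardsCs setCK cY; lia.
  by rewrite inE; exists j.
have ij : i != j by apply: contraNneq jY => <-.
have [t _ /setP/(_ (phi Y))] := sigmaP _ _ ij.
rewrite imset_f ?inE ?iY ?jY ?cY ?eqxx//.
by move/esym/and3P => [].
Qed.

End Comb.

From mathcomp Require Import boolp classical_sets functions.
Local Open Scope classical_set_scope.
(* [closure] would otherwise denote the graph closure of fingraph. *)
Local Notation closure := Defs.closure.

Lemma card_enum_bij (T : finType) m : #|T| = m -> exists e : 'I_m -> T, bijective e.
Proof.
move=> <-; exists (@enum_val T T); exists enum_rank.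
  exact: enum_valK.
exact: enum_rankK.
Qed.

(** * Closures, and spans of finite indexed families *)

Section Span.
Variables (P : Type) (L : set (set P)).
Implicit Types (X Y S : set P) (T : finType).

Lemma sub_closure X : X `<=` closure L X.
Proof. by move=> x Xx S _; apply. Qed.

Lemma closure_min X S : subspace L S -> X `<=` S -> closure L X `<=` S.
Proof. by move=> sS XS x; apply. Qed.

Lemma subspace_closure X : subspace L (closure L X).
Proof.
move=> p q l cp cq npq Ll lp lq x lx S sS XS.
by apply: (sS p q l) => //; [exact: cp | exact: cq].
Qed.

Lemma closure_sub X Y : X `<=` closure L Y -> closure L X `<=` closure L Y.
Proof. by move=> XY; apply: closure_min => //; exact: subspace_closure. Qed.

Lemma closure_mono X Y : X `<=` Y -> closure L X `<=` closure L Y.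
Proof. by move=> XY; apply: closure_sub => x /XY; exact: sub_closure. Qed.

Lemma closure_subspace S : subspace L S -> closure L S = S.
Proof. by move=> sS; apply/seteqP; split; [exact: closure_min | exact: sub_closure]. Qed.

Lemma closure1 p : closure L [set p] = [set p].
Proof. by apply: closure_subspace => x y l -> ->. Qed.

Lemma closure0 : closure L set0 = set0.
Proof. by apply: closure_subspace. Qed.

Definition span T (h : T -> P) (A : {set T}) := closure L (h @` [set` A]).

(** Indexing by a finite type makes repeated points dependent, so independent families are injective
    and their subsets become finite sets of indices. *)
Definition indep T (h : T -> P) := forall A i, span h A (h i) -> i \in A.

Lemma span_min T (h : T -> P) (A : {set T}) S :
  subspace L S -> (forall i, i \in A -> S (h i)) -> span h A `<=` S.
Proof. by move=> sS AS; apply: closure_min => // _ [i iA <-]; exact: AS. Qed.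

Lemma mem_span T (h : T -> P) (A : {set T}) i : i \in A -> span h A (h i).
Proof. by move=> iA; apply: sub_closure; exists i. Qed.

Lemma span_mono T (h : T -> P) (A B : {set T}) :
  A \subset B -> span h A `<=` span h B.
Proof. by move=> /fintype.subsetP AB; apply: closure_mono => _ [i /AB iB <-]; exists i. Qed.

Lemma span_comp T T' (h : T -> P) (s : T' -> T) A :
  span (h \o s) A = span h (s @: A)%SET.
Proof.
rewrite /span; congr closure; apply/seteqP; split=> [_ [i iA <-]|_ [_ /imsetP[i iA ->] <-]].
  by exists (s i) => //; apply: imset_f.
by exists i.
Qed.

Lemma spanT T (h : T -> P) : span h [set: T]%SET = closure L (range h).
Proof.
by rewrite /span; congr closure; apply/seteqP; split=> [_ [i _ <-]|_ [i _ <-]];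
  exists i => //; exact: finset.in_setT.
Qed.

Lemma eq_span T (h h' : T -> P) (A : {set T}) :
  {in A, h =1 h'} -> span h A = span h' A.
Proof.
move=> hh'; rewrite /span; congr closure.
by apply/seteqP; split=> _ [i iA <-]; exists i; rewrite ?hh'.
Qed.

Lemma span_enum T (h : T -> P) (A : {set T}) :
  closure L (range (h \o @enum_val T (mem A))) = span h A.
Proof.
rewrite /span; congr closure; apply/seteqP; split=> [_ [i _ <-]|_ [i iA <-]].
  by exists (enum_val i) => //; exact: enum_valP.
by exists (enum_rank_in iA i) => //=; rewrite enum_rankK_in.
Qed.

Lemma indep_inj T (h : T -> P) : indep h -> injective h.
Proof.
move=> ih i j hij; have /ih : span h [set j]%SET (h i).
  by rewrite hij; apply: mem_span; rewrite finset.inE.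
by rewrite finset.inE => /eqP.
Qed.

Lemma indep_comp T T' (h : T -> P) (s : T' -> T) :
  injective s -> indep h -> indep (h \o s).
Proof. by move=> si ih A i; rewrite span_comp => /ih; rewrite mem_imset. Qed.

Lemma eq_indep T (h h' : T -> P) : h =1 h' -> indep h -> indep h'.
Proof. by move=> /funext ->. Qed.

Lemma span_sub T (h : T -> P) A B : indep h -> span h A `<=` span h B -> A \subset B.
Proof. by move=> ih AB; apply/fintype.subsetP => i iA; apply: ih; apply: AB; exact: mem_span. Qed.

Lemma span_inj T (h : T -> P) : indep h -> injective (span h).
Proof.
by move=> ih A B AB; apply/eqP; rewrite finset.eqEsubset !(span_sub ih)// AB.
Qed.

Lemma span_nonempty T (h : T -> P) A x : span h A x -> exists i, i \in A.
Proof.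
case: (set_0Vmem A) => [->|[i iA]]; last by exists i.
rewrite /span (_ : _ @` _ = set0) ?closure0//.
by apply/seteqP; split=> // y [i]; rewrite /= finset.inE.
Qed.

(** In a spanning family of minimal size, a point in the span of others could be dropped; [lift i]
    enumerates the [m] remaining indices. *)
Lemma is_dim_indep m S : is_dim L m S ->
  exists h : 'I_m.+1 -> P, indep h /\ closure L (range h) = S.
Proof.
move=> [_ [h hS] min]; exists h; split=> // A i Ai; apply: contraT => iA.
suff: closure L (range (h \o lift i)) = S by move/min; rewrite ltnn.
rewrite -hS; apply/seteqP; split; first by apply: closure_mono => _ [j _ <-]; exists (lift i j).
have hj j : j != i -> closure L (range (h \o lift i)) (h j).
  rewrite eq_sym => /unlift_some[l -> _].
  by apply: sub_closure; exists l.
apply: closure_sub => _ [j _ <-].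
have [->|/hj//] := eqVneq j i.
apply: (span_min _ _ Ai); first exact: subspace_closure.
by move=> l lA; apply: hj; apply: contraNneq iA => <-.
Qed.

(** * Consequences of the exchange axiom: supports, cardinality and dimension *)

Section Exchange.
Hypothesis Hex : exchange_axiom L.

(** The case of [p] in the closure of [X], which the axiom excludes, holds by monotonicity. *)
Lemma exchange X p q : ~ closure L X q -> closure L (X `|` [set p]) q ->
  closure L (X `|` [set q]) p.
Proof.
move=> nq pq; have [pX|np] := pselect (closure L X p).
  by apply: closure_mono pX => x; left.
exact: Hex nq pq.
Qed.

(* Independence of the remaining points only has to be tested away from [o]:
   a dependency through [o] would be turned by exchange into one expressing [h o]. *)
Lemma indep_at T (h : T -> P) o :
  (forall (A : {set T}) i, o \notin A -> i != o -> span h A (h i) -> i \in A) ->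
  ~ span h (~: [set o])%SET (h o) -> indep h.
Proof.
move=> ho nho A i Ai; apply: contraT => niA; exfalso; apply: nho.
have [io|nio] := eqVneq i o.
  rewrite io in Ai niA; apply: span_mono Ai.
  by apply/fintype.subsetP => j jA; rewrite !finset.inE; apply: contraNneq niA => <-.
have nAi : ~ span h (A :\ o)%SET (h i).
  by move/ho => /(_ _ nio); rewrite !finset.inE eqxx (negPf niA) andbF => /(_ isT).
suff /(exchange nAi): closure L (h @` [set` (A :\ o)%SET] `|` [set h o]) (h i).
  apply: closure_mono => _ [[j /= + <-]|->]; last by exists i => //=; rewrite !finset.inE.
  by rewrite !finset.inE => /andP[jo _]; exists j => //=; rewrite !finset.inE.
apply: closure_mono Ai => _ [j jA <-].
have [->|jo] := eqVneq j o; [by right|left; exists j => //=].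
by rewrite !finset.inE jo.
Qed.

Definition upd T (h : T -> P) i c := fun j => if j == i then c else h j.

Lemma indep_upd T (h : T -> P) i c : indep h -> ~ span h (~: [set i])%SET c ->
  indep (upd h i c).
Proof.
have updE (A : {set T}) : i \notin A -> span (upd h i c) A = span h A.
  by move=> iA; apply: eq_span => j jA; rewrite /upd; case: eqVneq => // ji; rewrite -ji jA in iA.
move=> ih nc; apply: (@indep_at _ _ i) => [A j iA ji|].
  by rewrite updE// {1}/upd (negPf ji); exact: ih.
by rewrite updE ?finset.inE ?eqxx// /upd eqxx.
Qed.

Lemma indep_ext T (h : T -> P) p : indep h -> ~ closure L (range h) p ->
  indep (fun o : option T => if o is Some i then h i else p).
Proof.
move=> ih np; apply: (@indep_at _ _ None) => [A [i|]// nA _ Ai|].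
  have := ih [set j | Some j \in A]%SET i; rewrite finset.inE; apply.
  apply: closure_mono Ai => _ [[j|] jA <-]; last by rewrite /= (negPf nA) in jA.
  by exists j => //=; rewrite finset.inE.
apply: contra_not np; apply: closure_mono => y [[j|]]; first by exists j.
by rewrite /= !finset.inE.
Qed.

(** If [a] in a minimal [A0] were missing from some [A] spanning [x], exchange would put [h a] in
    the closure of [x] and the rest of [A0], hence in the span of the points other than [h a]. *)
Lemma support T (h : T -> P) x : indep h -> closure L (range h) x ->
  exists2 A0, span h A0 x & forall A, span h A x -> A0 \subset A.
Proof.
move=> ih; rewrite -spanT => hx.
have /ex_minset[A0 /minsetP[/asboolP A0x minA0]] :
  exists A, [pred A : {set T} | `[< span h A x >]] A by exists [set: T]%SET; exact/asboolP.
exists A0 => // A Ax; apply/fintype.subsetP => a aA0; apply: contraT => naA.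
have nx : ~ span h (A0 :\ a)%SET x.
  move=> /asboolP/minA0/(_ (subD1set _ _)) /setP/(_ a).
  by rewrite aA0 !finset.inE eqxx.
suff /ih: span h (~: [set a])%SET (h a) by rewrite !finset.inE eqxx.
suff /(exchange nx): closure L (h @` [set` (A0 :\ a)%SET] `|` [set h a]) x.
  apply: closure_sub => _ [[j + <-]|->].
    by rewrite /= !finset.inE => /andP[ja _]; apply: mem_span; rewrite !finset.inE.
  apply: span_mono Ax; apply/fintype.subsetP => j jA; rewrite !finset.inE.
  by apply: contraNneq naA => <-.
apply: closure_mono A0x => _ [j jA <-].
have [->|ja] := eqVneq j a; [by right|left; exists j => //=].
by rewrite !finset.inE ja.
Qed.

(** Points of [h'] are traded one by one for points of [h], keeping the range of [h'] spanned. *)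
Lemma steinitz T T' (h : T -> P) (h' : T' -> P) : indep h ->
  (forall i, closure L (range h') (h i)) -> #|T| <= #|T'|.
Proof.
move=> ih hh'.
pose spans (A : {set T}) (W : {set T'}) :=
  range h' `<=` closure L (h @` [set` A] `|` h' @` [set` W]).
suff /(_ _ [set: T]%SET (erefl _)) [W le _] :
    forall m (A : {set T}), #|A| = m -> exists2 W : {set T'}, #|W| + #|A| <= #|T'| & spans A W.
  by rewrite cardsT in le; apply: leq_trans le; rewrite leq_addl.
elim=> [|m IHm] A Am.
  exists [set: T']%SET; first by rewrite Am addn0 cardsT.
  by move=> _ [i _ <-]; apply: sub_closure; right; exists i => //=; rewrite finset.in_setT.
have /card_gt0P[a aA] : 0 < #|A| by rewrite Am.
have Aam : #|(A :\ a)%SET| = m by have := cardsD1 a A; rewrite aA Am => -[].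
have [W leW spW] := IHm _ Aam.
set X := h @` [set` (A :\ a)%SET].
have nXa : ~ closure L X (h a) by move/ih; rewrite !finset.inE eqxx.
(* [W0] is an inclusion-minimal set of remaining points that together with [X] spans [h a]; it is
   nonempty, and any [w] in it can be exchanged for [h a]. *)
have /ex_minset[W0 /minsetP[/andP[W0W /asboolP W0a] minW0]] :
    exists V : {set T'}, [pred V : {set T'} | (V \subset W) &&
      `[< closure L (X `|` h' @` [set` V]) (h a) >]] V.
  exists W; rewrite /= subxx; apply/asboolP.
  exact: closure_sub spW _ (hh' a).
have [W00|[w wW0]] := set_0Vmem W0.
  exfalso; apply: nXa; apply: closure_mono W0a => x [//|[i]].
  by rewrite W00 /= finset.inE.
exists (W :\ w)%SET.
  have := cardsD1 w W; rewrite (fintype.subsetP W0W)// => eqW.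
  by apply: leq_trans leW; rewrite Am Aam eqW add1n addSn addnS.
pose X' := X `|` h' @` [set` (W0 :\ w)%SET].
have nX'a : ~ closure L X' (h a).
  move=> X'a; have /setP/(_ w) : (W0 :\ w)%SET = W0.
    apply: minW0; last exact: subD1set.
    by apply/andP; split; [exact: fintype.subset_trans (subD1set _ _) W0W | exact/asboolP].
  by rewrite wW0 !finset.inE eqxx.
have X'w : closure L (X' `|` [set h a]) (h' w).
  apply: exchange => //; apply: closure_mono W0a => x [Xx|[v vW0 <-]].
    by left; left.
  have [->|vw] := eqVneq v w; [by right|left; right; exists v => //=].
  by rewrite !finset.inE vw.
have hw : closure L (h @` [set` A] `|` h' @` [set` (W :\ w)%SET]) (h' w).
  apply: closure_mono X'w => _ [[[i + <-]|[i + <-]]|->].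
  - by rewrite /= finset.inE => /andP[_ iA]; left; exists i.
  - rewrite /= !finset.inE => /andP[iw iW0]; right; exists i => //=.
    by rewrite !finset.inE iw (fintype.subsetP W0W).
  - by left; exists a.
move=> x /spW; apply: closure_sub => _ [[i + <-]|[i /= iW <-]].
  by rewrite /= finset.inE => /andP[_ iA]; apply: sub_closure; left; exists i.
have [->//|iw] := eqVneq i w.
by apply: sub_closure; right; exists i => //=; rewrite !finset.inE iw.
Qed.

(** The Steinitz bound compares an enumeration of the points indexed by [A] with any other family
    spanning the same subspace. *)
Lemma Grass_span T (h : T -> P) k A : indep h -> Grass L k (span h A) <-> #|A| = k.+1.
Proof.
move=> ih.
have ie : indep (h \o @enum_val T (mem A)).
  by apply: indep_comp => //; exact: enum_val_inj.
split=> [/is_dim_indep[d [id dA]]|Ak]; last first.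
  split; [exact: subspace_closure| |].
    by move: (@enum_val T (mem A)) (span_enum h A); rewrite Ak => e eA; exists (h \o e).
  move=> j d dA; have := steinitz (h' := d) ie; rewrite !card_ord -Ak; apply=> i.
  by rewrite dA -span_enum; apply: sub_closure; exists i.
apply/eqP; rewrite eqn_leq; apply/andP; split.
  have := steinitz (h' := d) ie; rewrite !card_ord; apply=> i.
  by rewrite dA -span_enum; apply: sub_closure; exists i.
have := steinitz (h' := h \o @enum_val T (mem A)) id; rewrite !card_ord; apply=> i.
by rewrite span_enum -dA; apply: sub_closure; exists i.
Qed.

(** * Frames, that is, independent families indexed by ['I_n.+1], and bases *)

Section Dimension.
Variables (n : nat).
Hypothesis Hdim : is_dim L n setT.

Lemma indep_card T (h : T -> P) : indep h -> #|T| <= n.+1.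
Proof.
have [_ [d dT] _] := Hdim.
by move=> ih; have := steinitz (h' := d) ih; rewrite card_ord; apply=> i; rewrite dT.
Qed.

(** Points of [S] outside the closure are adjoined one at a time, by induction on the room left
    below the bound [n.+1]. *)
Lemma indep_extend T (h : T -> P) S : indep h ->
  exists (T' : finType) (h' : T' -> P),
    [/\ indep h', range h `<=` range h', range h' `<=` range h `|` S &
        S `<=` closure L (range h')].
Proof.
have [m] := ubnP (n.+1 - #|T|); elim: m T h => // m IHm T h ltm ih.
have [Sh|/existsNP[p /not_implyP[Sp np]]] := pselect (S `<=` closure L (range h)).
  by exists T, h; split=> // x; left.
have ie := indep_ext ih np; have := indep_card ie; rewrite card_option => leT.
have [|T' [h' [ih' hh' h'S Sh']]] := IHm _ _ _ ie.
  by rewrite card_option; move: ltm; rewrite subSn.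
exists T', h'; split=> //.
  by move=> _ [i _ <-]; apply: hh'; exists (Some i).
move=> x /h'S [[[i|] _ <-]|Sx]; [by left; exists i | by right | by right].
Qed.

Lemma frame_span (h : 'I_n.+1 -> P) : indep h -> closure L (range h) = setT.
Proof.
move=> ih; apply/seteqP; split=> // p _; apply: contrapT => np.
by have := indep_card (indep_ext ih np); rewrite card_option card_ord ltnn.
Qed.

Lemma frame_reindex T (h : T -> P) : indep h -> closure L (range h) = setT ->
  exists2 h' : 'I_n.+1 -> P, indep h' & range h' = range h.
Proof.
move=> ih hT; have rg m (e : 'I_m -> T) : bijective e -> range (h \o e) = range h.
  move=> [e' _ eK]; apply/seteqP; split=> [_ [i _ <-]|_ [i _ <-]]; first by exists (e i).
  by exists (e' i) => //=; rewrite eK.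
have cT : #|T| = n.+1.
  apply/eqP; rewrite eqn_leq (indep_card ih)/=.
  have [e be] := card_enum_bij (erefl #|T|).
  by have [_ _ min] := Hdim; apply: (min _ (h \o e)); rewrite rg.
have [e be] := card_enum_bij cT.
by exists (h \o e); [exact: indep_comp (bij_inj be) ih | exact: rg].
Qed.

Lemma indep_frame T (h : T -> P) : indep h ->
  exists (h' : 'I_n.+1 -> P) (s : T -> 'I_n.+1),
    [/\ indep h', injective s & h' \o s =1 h].
Proof.
move=> ih; have [T' [h1 [ih1 hh1 _ T1]]] := indep_extend setT ih.
have [|h2 ih2 h21] := frame_reindex ih1; first by apply/seteqP.
rewrite -h21 in hh1.
have /choice[s sE] : forall i, exists j, h2 j = h i.
  by move=> i; have [|j _ <-] := hh1 (h i); [exists i | exists j].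
exists h2, s; split=> // i j /(congr1 h2); rewrite !sE; exact: indep_inj.
Qed.

(** Extending the empty family inside [B] gives a finite independent part of [B] that spans
    everything; independence of [B] as a set forces it to be all of [B]. *)
Lemma base_frame B : base L B -> exists2 h : 'I_n.+1 -> P, indep h & range h = B.
Proof.
move=> [iB BT].
have i0 : indep (of_void P) by move=> A [].
have [T [h [ih _ hB Bh]]] := indep_extend B i0.
have {}hB : range h `<=` B by move=> x /hB[[[]]|].
have hT : closure L (range h) = setT.
  apply/seteqP; split=> // x _; have : closure L B x by rewrite BT.
  exact: closure_sub.
have [h' ih' h'h] := frame_reindex ih hT.
exists h' => //; rewrite h'h; apply/seteqP; split=> // p Bp; apply: contrapT => np.
by apply: iB; exists (range h); rewrite hT BT; split=> //; split=> // /(_ p Bp).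
Qed.

Lemma frame_base (h : 'I_n.+1 -> P) : indep h -> base L (range h).
Proof.
move=> ih; split; last exact: frame_span.
move=> [Y [[Yh nhY] YT]]; apply: nhY => _ [i _ <-]; apply: contrapT => nY.
suff /ih: span h (~: [set i])%SET (h i) by rewrite !finset.inE eqxx.
have : closure L Y (h i) by rewrite YT; apply: sub_closure; exists i.
apply: closure_mono => y Yy; have [j _ hj] := Yh _ Yy.
by exists j => //=; rewrite !finset.inE; apply/negP => /eqP ji; apply: nY; rewrite -ji hj.
Qed.

Lemma base_subsetP k T (h : T -> P) S : indep h ->
  base_subset L k (range h) S <-> exists2 A : {set T}, #|A| = k.+1 & span h A = S.
Proof.
move=> ih; split=> [[GS [Y [Yh YS]]]|[A Ak <-]]; last first.
  split; first exact/Grass_span.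
  by exists (h @` [set` A]); split=> // _ [i _ <-]; exists i.
have YE : h @` [set` [set i | `[< Y (h i) >]]%SET] = Y.
  apply/seteqP; split=> [_ [i + <-]|y Yy]; first by rewrite /= finset.inE => /asboolP.
  by have [i _ hi] := Yh _ Yy; exists i => //=; rewrite finset.inE hi; apply/asboolP.
have E : span h [set i | `[< Y (h i) >]]%SET = S by rewrite /span YE.
by exists [set i | `[< Y (h i) >]]%SET => //; by apply/(Grass_span k _ ih); rewrite E.
Qed.

End Dimension.
End Exchange.
End Span.

(** * Comparing two frames and moving a single point of a frame *)

Section Frames.
Variables (P : Type) (L : set (set P)).
Hypothesis Hex : exchange_axiom L.
Implicit Types (T : finType).

Lemma span1 T (h : T -> P) i : span L h [set i]%SET = [set h i].
Proof.
rewrite /span -(closure1 L (h i)); congr closure.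
apply/seteqP; split=> [_ [j + <-]|_ ->]; first by rewrite /= finset.inE => /eqP ->.
by exists i => //=; rewrite finset.inE.
Qed.

Lemma span_upd T (h : T -> P) i c (A : {set T}) : i \notin A -> span L (upd h i c) A = span L h A.
Proof.
move=> iA; apply: eq_span => j jA; rewrite /upd; case: eqVneq => // ji.
by rewrite -ji jA in iA.
Qed.

Lemma indep_point p : indep L (fun _ : unit => p).
Proof. by move=> A [] Ai; have [[]] := span_nonempty Ai. Qed.

(** The index type [option unit] matches the shape of the families produced by [indep_ext]. *)
Definition two_points (p q : P) (o : option unit) := if o is Some _ then p else q.

Lemma indep_pair p q : p <> q -> indep L (two_points p q).
Proof.
move=> pq; apply: (indep_ext Hex (@indep_point p)) => qp; apply: pq.
suff : closure L [set p] q by rewrite closure1 => ->.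
by apply: closure_mono qp => _ [_ _ <-].
Qed.

(** A line is a subspace, since a line sharing two points with it coincides with it. *)
Lemma line_pair (HL : linear_space L) l p q :
  L l -> l p -> l q -> p <> q -> closure L (range (two_points p q)) = l.
Proof.
move=> Ll lp lq pq; have [_ _ line] := HL.
have lineE x y m : x <> y -> L m -> m x -> m y -> l x -> l y -> m = l.
  move=> xy Lm mx my lx ly; have [m0 [_ _ _ m0P]] := line x y xy.
  by rewrite (m0P m) // (m0P l).
apply/seteqP; split.
  apply: closure_min => [x y m lx ly xy Lm mx my|_ [[u|] _ <-]//].
  by rewrite (lineE x y m).
have pqc x : range (two_points p q) x -> closure L (range (two_points p q)) x by exact: sub_closure.
apply: (subspace_closure (p := p) (q := q)) => //; apply: pqc.
- by exists (Some tt).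
- by exists None.
Qed.

(** A point of [d] outside the range of [h] would lie in the span of the other points of [d]. *)
Lemma range_eq T T' (h : T -> P) (d : T' -> P) :
  closure L (range h) = setT -> indep L d -> range h `<=` range d -> range h = range d.
Proof.
move=> hT id hd; apply/seteqP; split=> // _ [a _ <-]; apply: contrapT => na.
suff /id : span L d (~: [set a])%SET (d a) by rewrite !finset.inE eqxx.
have : closure L (range h) (d a) by rewrite hT.
apply: closure_mono => x hx; have [b _ db] := hd _ hx.
by exists b => //=; rewrite !finset.inE; apply/eqP => ba; apply: na; rewrite -ba db.
Qed.

(* If [R] separates the points of [h], then each [h i] is the intersection of the
   members of [R] through it, and such an intersection contains a point of [d]. *)
Lemma separating_range T T' (h : T -> P) (d : T' -> P) (R : set {set T}) :
  indep L h -> closure L (range h) = setT -> indep L d -> closure L (range d) = setT ->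
  (forall Y, R Y -> exists Z, span L d Z = span L h Y) ->
  (forall i j, i != j -> exists Y, [/\ R Y, i \in Y & j \notin Y]) ->
  range h `<=` range d.
Proof.
move=> ih hT id dT Rd Rsep _ [i _ <-].
have [|A0 A0i minA0] := support Hex (x := h i) id; first by rewrite dT.
have [a aA0] := span_nonempty A0i.
have [|A1 A1a minA1] := support Hex (x := d a) ih; first by rewrite hT.
(* [A1], the support of [d a] in [h], lies in every [Y] of [R] through [i]. *)
have A1i : A1 \subset [set i]%SET.
  apply/fintype.subsetP => j jA1; rewrite finset.inE; apply: contraT.
  rewrite eq_sym => /Rsep[Y [RY iY jY]].
  have [Z ZY] := Rd _ RY.
  have /fintype.subsetP/(_ _ aA0) aZ : A0 \subset Z.
    by apply: minA0; rewrite ZY; exact: mem_span.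
  have /fintype.subsetP/(_ _ jA1) : A1 \subset Y.
    by apply: minA1; rewrite -ZY; exact: mem_span.
  by rewrite (negPf jY).
by exists a => //; have := span_mono A1i A1a; rewrite span1 => ->.
Qed.

(* Replace [h i] by a third point of the line through [h i] and [h j]. *)
Lemma slide T (h : T -> P) i j : linear_space L -> axiom_P2 L -> indep L h -> i != j ->
  exists d : T -> P, [/\ indep L d, ~ range d `<=` range h &
    forall Y : {set T}, (i \in Y -> j \in Y) -> span L d Y = span L h Y].
Proof.
move=> [_ _ line] HP2 ih ij.
have hij : h i <> h j by move/(indep_inj ih)/eqP; rewrite (negPf ij).
have [l [Ll li lj _]] := line _ _ hij.
have [c [lc ci cj]] : exists c, [/\ l c, c <> h i & c <> h j].
  have [p [q [r [lp lq lr [pq qr pr]]]]] := HP2 _ Ll.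
  have [pi|pi] := pselect (p = h i).
    have [qj|qj] := pselect (q = h j).
      by exists r; split=> //; [rewrite -pi|rewrite -qj] => /esym.
    by exists q; split=> //; rewrite -pi => /esym.
  have [pj|pj] := pselect (p = h j); last by exists p.
  have [qi|qi] := pselect (q = h i).
    by exists r; split=> //; [rewrite -qi|rewrite -pj] => /esym.
  by exists q; split=> //; rewrite -pj => /esym.
(* Otherwise the line through [c] and [h j] would put [h i] in that span as well. *)
have nc : ~ span L h (~: [set i])%SET c.
  move=> ncs; suff /ih : span L h (~: [set i])%SET (h i) by rewrite !finset.inE eqxx.
  apply: (subspace_closure (p := c) (q := h j)) li => //.
  by apply: mem_span; rewrite !finset.inE eq_sym.
exists (upd h i c); split; first exact: indep_upd.
  move=> sub; have [|m _ hm] := sub c; first by exists i => //; rewrite /upd eqxx.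
  apply: nc; rewrite -hm; apply: mem_span; rewrite !finset.inE.
  by apply/eqP => mi; apply: ci; rewrite -hm mi.
move=> Y iY; have [/[dup] iY0 /iY jY|] := boolP (i \in Y); last exact: span_upd.
set d := upd h i c.
have dj : d j = h j by rewrite /d /upd eq_sym (negPf ij).
have di : d i = c by rewrite /d /upd eqxx.
have dm m : m != i -> d m = h m by rewrite /d /upd => /negPf ->.
(* With [j] in [Y], the pairs [h i], [h j] and [c], [h j] determine the same line [l]. *)
apply/seteqP; split; apply: (span_min (@subspace_closure _ _ _)) => m mY.
  have [->|/dm ->] := eqVneq m i; last exact: mem_span.
  by rewrite di; apply: (subspace_closure (p := h i) (q := h j)) lc => //; exact: mem_span.
have [->|mi] := eqVneq m i; last by rewrite -dm//; exact: mem_span.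
apply: (subspace_closure (p := c) (q := h j)) li => //.
  by rewrite -di; exact: mem_span.
by rewrite -dj; exact: mem_span.
Qed.

End Frames.

(** [A2] is chosen to avoid [D] and the rest of [A1]: the union takes 2k + 1 indices and [D] at most
    one more. The two spans will cut out the point with index [l]. *)
Lemma sets_meeting_at (T : finType) k (l : T) (D : {set T}) : l \notin D -> #|D| <= 1 ->
  2 * k + 2 <= #|T| -> exists A1 A2 : {set T}, [/\ #|A1| = k.+1, #|A2| = k.+1,
    (A1 :&: A2 = [set l])%SET, [disjoint A1 & D]%B & [disjoint A2 & D]%B].
Proof.
move=> lD D1 leT.
have [||A1 [lA1 dA1 cA1]] := @ex_between _ [set l]%SET D k.
- by rewrite disjoints1.
- by rewrite cards1; lia.
rewrite cards1 addn1 in cA1; rewrite finset.sub1set in lA1.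
have cA1l : #|(A1 :\ l)%SET| = k by have := cardsD1 l A1; rewrite lA1 cA1 => -[].
have [||A2 [lA2 dA2 cA2]] := @ex_between _ [set l]%SET (D :|: A1 :\ l)%SET k.
- by rewrite disjoints1 !finset.inE eqxx (negPf lD).
- by rewrite cards1 cardsU cA1l; lia.
rewrite cards1 addn1 in cA2; rewrite finset.sub1set in lA2.
exists A1, A2; split=> //.
  apply/setP => x; rewrite !finset.inE; have [->|xl] := eqVneq x l; first by rewrite lA1 lA2.
  apply/negP => /andP[xA1 xA2]; have := disjointFr dA2 xA2.
  by rewrite !finset.inE xl xA1 orbT.
by apply: disjointWr dA2; exact: finset.subsetUl.
Qed.

(** * Frames matched by [f], and the resulting action on points *)

Section Main.
Variables (P P' : Type) (L : set (set P)) (L' : set (set P')) (n k : nat).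
Hypotheses (HL : linear_space L) (HL' : linear_space L').
Hypotheses (Hdim : is_dim L n setT) (Hdim' : is_dim L' n setT).
Hypotheses (Hex : exchange_axiom L) (Hex' : exchange_axiom L').
Hypotheses (HP2 : axiom_P2 L) (Hnk : 2 * k + 1 < n).
Variable f : set P -> set P'.
Hypothesis Hbij : set_bij (Grass L k) (Grass L' k) f.
Hypothesis Hf : forall B, base L B ->
  exists B', base L' B' /\ f @` base_subset L k B = base_subset L' k B'.
Hypothesis Hfinv : forall B', base L' B' -> exists B, base L B /\
  [set S | Grass L k S /\ base_subset L' k B' (f S)] = base_subset L k B.

Let I := 'I_n.+1.

(** The bijection of bases that induces [f] is recorded by giving both frames the same index set. *)
Definition matched (h : I -> P) (h' : I -> P') := [/\ indep L h, indep L' h' &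
  forall A : {set I}, #|A| = k.+1 -> f (span L h A) = span L' h' A].

Let ltkI : 2 * k + 2 < #|I|. Proof. by rewrite card_ord; lia. Qed.

Let ex_sep (i j : I) : i != j -> exists Y : {set I}, [/\ i \in Y, j \notin Y & #|Y| = k.+1].
Proof.
move=> ij; have [||Y [iY jY cY]] := @ex_between _ [set i]%SET [set j]%SET k.
- by rewrite disjoints1 finset.inE.
- by rewrite !cards1 card_ord; lia.
exists Y; split; first by rewrite -finset.sub1set.
- by rewrite disjoint_sym disjoints1 in jY.
- by rewrite cY cards1 addn1.
Qed.

(** [f] acts on the index sets of size [k.+1] as a map [phi]; sliding one point of [h] supplies the
    separation property required by [sep_perm]. *)
Lemma matching_perm (h : I -> P) (h0 : I -> P') : indep L h -> indep L' h0 ->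
  f @` base_subset L k (range h) = base_subset L' k (range h0) ->
  exists2 s : I -> I, injective s & matched h (h0 \o s).
Proof.
move=> ih ih0 fhh0; have [_ f_inj _] := Hbij.
have f_eq (d : I -> P) (A A' : {set I}) : indep L d -> #|A| = k.+1 -> #|A'| = k.+1 ->
    f (span L h A) = f (span L d A') -> span L h A = span L d A'.
  by move=> id cA cA'; apply: f_inj; rewrite inE; apply/Grass_span.
(* The values of [phi] are constrained only at sets of size [k.+1]. *)
have /choice[phi phiP] : forall A : {set I}, exists Z : {set I}, #|A| = k.+1 ->
    #|Z| = k.+1 /\ span L' h0 Z = f (span L h A).
  move=> A; have [cA|] := eqVneq #|A| k.+1; last by move=> /eqP nA; exists A.
  have : base_subset L' k (range h0) (f (span L h A)).
    by rewrite -fhh0; exists (span L h A) => //; apply/base_subsetP => //; exists A.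
  by move/(base_subsetP Hex' _ _ ih0) => [Z cZ ZE]; exists Z.
have [|Y /phiP[]||i j ij|s s_inj sP] := @sep_perm _ k phi => //.
- move=> Y Y'; rewrite !inE => /eqP cY /eqP cY' E.
  by apply: (span_inj ih); apply: f_eq => //; rewrite -!(phiP _ _).2// E.
- have [d [id ndh dY]] := slide Hex HL HP2 ih ij.
  have [B0 [/(base_frame Hex' Hdim')[d0 id0 <-] fdd0]] := Hf (frame_base Hex Hdim id).
  apply: contrapT => nsep.
  (* If no pair [i'], [j'] works, the images of the sets outside [sep i j] separate all indices of
     [h0]. *)
  pose R := [set Z | exists2 Y : {set I}, #|Y| = k.+1 /\ (i \in Y -> j \in Y) & phi Y = Z].
  (* Sets outside [sep i j] have the same span in [d] and in [h], so the members of [R] also give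
     spans of [d0]. *)
  have h0d0 : range h0 = range d0.
    apply: (range_eq (frame_span Hex' Hdim' ih0) id0).
    apply: (separating_range Hex' (R := R) ih0 (frame_span Hex' Hdim' ih0)
                             id0 (frame_span Hex' Hdim' id0)).
      move=> _ [Y [cY ijY] <-].
      have : base_subset L' k (range d0) (f (span L d Y)).
        by rewrite -fdd0; exists (span L d Y) => //; apply/base_subsetP => //; exists Y.
      move/(base_subsetP Hex' _ _ id0) => [Z cZ ZE]; exists Z.
      by rewrite ZE dY// (phiP _ cY).2.
    move=> i' j' ij'; apply: contrapT => nR; apply: nsep; exists i', j'; split=> // Y cY i'Y j'Y.
    apply: contraT; rewrite negb_and negbK -implybE => /implyP ijY; exfalso; apply: nR.
    by exists (phi Y); split=> //; exists Y.
  (* [f] now sends the base subsets of [h] and [d] to the same family; by injectivity the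
     k-dimensional spans of [d] are spans of [h], so all points of [d] are points of [h], which
     [slide] excludes. *)
  apply: ndh; apply: (separating_range Hex (R := [set Y | #|Y| = k.+1]) id (frame_span Hex Hdim id)
                             ih (frame_span Hex Hdim ih)).
    move=> Y /= cY.
    have : (f @` base_subset L k (range h)) (f (span L d Y)).
      rewrite fhh0 h0d0 -fdd0.
      by exists (span L d Y) => //; apply/base_subsetP => //; exists Y.
    move=> [_ /(base_subsetP Hex _ _ ih)[Z cZ <-] E]; exists Z; exact: f_eq.
  by move=> a b /ex_sep[Y [? ? ?]]; exists Y.
- exists s => //; split=> [//||A cA]; first exact: indep_comp.
  by rewrite -(phiP _ cA).2 sP// [RHS]span_comp.
Qed.

Lemma matched_left (h : I -> P) : indep L h -> exists h', matched h h'.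
Proof.
move=> ih; have [B' [/(base_frame Hex' Hdim')[h0 ih0 <-] E]] := Hf (frame_base Hex Hdim ih).
by have [s _ m] := matching_perm ih ih0 E; exists (h0 \o s).
Qed.

Lemma matched_right (h0 : I -> P') : indep L' h0 ->
  exists h h', matched h h' /\ range h' = range h0.
Proof.
move=> ih0; have [_ _ f_surj] := Hbij.
have [B [/(base_frame Hex Hdim)[h ih <-] E]] := Hfinv (frame_base Hex' Hdim' ih0).
have [|s s_inj m] := matching_perm ih ih0.
  (* Surjectivity of [f] turns the preimage condition into an equality of images. *)
  rewrite -E; apply/seteqP; split=> [_ [S [_ fS] <-]//|S' S'B].
  have [S GS SE] := f_surj _ S'B.1.
  by exists S => //; split=> //; rewrite SE.
exists h, (h0 \o s); split=> //; apply/seteqP; split=> _ [i _ <-]; first by exists (s i).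
by have [s' _ ss'] := injF_bij s_inj; exists (s' i) => //=; rewrite ss'.
Qed.

(** The point [h' l] lies in the spans of [D1] and [D2] in [g'], so its support there is contained
    in their intersection, the single index [m]. *)
Lemma matched_point h h' g g' (A1 A2 D1 D2 : {set I}) l m :
  matched h h' -> matched g g' ->
  #|A1| = k.+1 -> #|A2| = k.+1 -> #|D1| = k.+1 -> #|D2| = k.+1 ->
  l \in A1 -> l \in A2 -> (D1 :&: D2 = [set m])%SET ->
  span L h A1 = span L g D1 -> span L h A2 = span L g D2 -> h' l = g' m.
Proof.
move=> [ih ih' hE] [ig ig' gE] cA1 cA2 cD1 cD2 lA1 lA2 D12 E1 E2.
have [|A0 A0l minA0] := support Hex' (x := h' l) ig'; first by rewrite (frame_span Hex' Hdim').
have : A0 \subset [set m]%SET.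
  rewrite -D12 finset.subsetI !minA0//.
    by rewrite -gE// -E2 hE//; exact: mem_span.
  by rewrite -gE// -E1 hE//; exact: mem_span.
by move=> A0m; have := span_mono A0m A0l; rewrite span1.
Qed.

(* Two frames through the same point are joined by a chain of frames through
   it, consecutive ones differing in one point. *)
Lemma matched_agree h h' g g' l m :
  matched h h' -> matched g g' -> h l = g m -> h' l = g' m.
Proof.
move=> mh mg; have [ig _ _] := mg.
(* The induction is on the number of points of [h] that are not points of [g]. *)
have [N] := ubnP #|[set i | ~~ `[< range g (h i) >]]%SET|.
elim: N h h' mh => // N IHN h h' mh ltN hl; have [ih _ _] := mh.
have [hg|/existsNP[i ngi]] := pselect (forall i, range g (h i)).
  (* When all points of [h] are points of [g], the frame [h] is a reindexing of [g]. *)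
  have /choice[s sE] : forall i, exists j, g j = h i by move=> i; have [j _ <-] := hg i; exists j.
  have s_inj : injective s by move=> i j /(congr1 g); rewrite !sE; exact: (indep_inj ih).
  have sl : s l = m by apply: (indep_inj ig); rewrite sE.
  have hgs (A : {set I}) : span L h A = span L g (s @: A)%SET.
    by rewrite -span_comp; apply: eq_span => i _ /=; rewrite sE.
  have [|||A1 [A2 [cA1 cA2 A12 _ _]]] := @sets_meeting_at _ k l finset.set0.
  - by rewrite finset.inE.
  - by rewrite cards0.
  - by rewrite ltnW.
  have := finset.set11 l; rewrite -A12 finset.inE => /andP[lA1 lA2].
  apply: (matched_point mh mg cA1 cA2 _ _ lA1 lA2 _ (hgs A1) (hgs A2)); rewrite ?card_imset//.
  by rewrite -finset.imsetI ?A12 ?finset.imset_set1 ?sl// => x y _ _; exact: s_inj.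
(* The points of [g] span everything, so one of them avoids the span of the points of [h] other than
   [h i] and can replace [h i]. *)
have [j nj] : exists j, ~ span L h (~: [set i])%SET (g j).
  apply/existsNP => gh; suff /ih : span L h (~: [set i])%SET (h i) by rewrite !finset.inE eqxx.
  have : closure L (range g) (h i) by rewrite (frame_span Hex Hdim).
  by apply: closure_min; [exact: subspace_closure | move=> _ [j _ <-]].
have li : l != i by apply/eqP => li; apply: ngi; rewrite -li hl; exists m.
have [d' md] := matched_left (indep_upd Hex ih nj).
have dl : upd h i (g j) l = g m by rewrite /upd (negPf li).
rewrite -(IHN _ _ md _ dl); last first.
  rewrite ltnS in ltN; apply: leq_trans ltN; apply: proper_card; apply/properP; split.
    apply/fintype.subsetP => x; rewrite !finset.inE /upd; case: eqVneq => // _ /asboolP[].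
    by exists j.
  exists i; rewrite !finset.inE; first exact/asboolP.
  by rewrite negbK /upd eqxx; apply/asboolP; exists j.
(* Both sets avoid [i], so the replacement does not change their spans. *)
have [|||A1 [A2 [cA1 cA2 A12 dA1 dA2]]] := @sets_meeting_at _ k l [set i]%SET.
- by rewrite finset.inE.
- by rewrite cards1.
- by rewrite ltnW.
have := finset.set11 l; rewrite -A12 finset.inE => /andP[lA1 lA2].
rewrite disjoint_sym disjoints1 in dA1; rewrite disjoint_sym disjoints1 in dA2.
by apply: (matched_point mh md cA1 cA2 cA1 cA2 lA1 lA2 A12); rewrite span_upd.
Qed.

(** Every point belongs to a frame, every frame is matched, and [matched_agree] makes the image
    independent of the frame. *)
Lemma point_map : exists g : P -> P', forall h h', matched h h' -> h' =1 g \o h.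
Proof.
have /choice[g gE] : forall p, exists p', forall h h' i, matched h h' -> h i = p -> h' i = p'.
  move=> p; have [h [s [ih _ hs]]] := indep_frame Hex Hdim (@indep_point _ L p).
  have [h' mh] := matched_left ih; exists (h' (s tt)) => g g' i mg gi.
  by apply: (matched_agree mg mh); rewrite gi; have := hs tt.
by exists g => h h' mh i; exact: (gE (h i) h h' i mh).
Qed.

(** * The point map is a collineation inducing [f] *)

Section PointMap.
Variable g : P -> P'.
Hypothesis gE : forall h h', matched h h' -> h' =1 g \o h.

Lemma indep_map (T : finType) (h : T -> P) : indep L h -> indep L' (g \o h).
Proof.
move=> ih; have [H [s [iH s_inj Hs]]] := indep_frame Hex Hdim ih.
have [H' mH] := matched_left iH; have [_ iH' _] := mH.
apply: eq_indep (indep_comp s_inj iH') => t.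
by rewrite /= (gE mH) -Hs.
Qed.

Lemma map_inj : injective g.
Proof.
move=> p q gpq; apply: contrapT => /(indep_pair Hex)/indep_map ipq.
by have /(_ (Some tt) None gpq) := indep_inj ipq.
Qed.

(** A frame extending [g \o h] is, up to order, the image of a frame of the source by
    [matched_right]; this rests on the condition on the inverse of [f]. *)
Lemma indep_map_inv (T : finType) (h : T -> P) : indep L' (g \o h) -> indep L h.
Proof.
move=> igh; have [K [s [iK _ Ks]]] := indep_frame Hex' Hdim' igh.
have [H [H' [mH rH']]] := matched_right iK; have [iH _ _] := mH.
have /choice[u uE] : forall t, exists i, H i = h t.
  move=> t; have [i _ Hi] : range H' (g (h t)).
    by rewrite rH'; exists (s t) => //; exact: Ks.
  by exists i; apply: map_inj; rewrite -Hi (gE mH).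
apply: (@eq_indep _ _ _ (H \o u)) => //; apply: indep_comp => // t t' /(congr1 H).
by rewrite !uE => tt'; apply: (indep_inj igh); rewrite /= tt'.
Qed.

Lemma map_surj p' : exists p, g p = p'.
Proof.
have [K [s [iK _ Ks]]] := indep_frame Hex' Hdim' (@indep_point _ L' p').
have [H [H' [mH rH']]] := matched_right iK.
have [i _ Hi] : range H' p' by rewrite rH'; exists (s tt) => //; exact: Ks.
by exists (H i); rewrite -Hi (gE mH).
Qed.

(** A point is outside the closure of an independent family exactly when adjoining it keeps the
    family independent, and [g] preserves and reflects independence. *)
Lemma map_closure (T : finType) (h : T -> P) : indep L h ->
  g @` closure L (range h) = closure L' (range (g \o h)).
Proof.
move=> ih; apply/seteqP; split=> [_ [x hx <-]|x'].
  apply: contrapT => /(indep_ext Hex' (indep_map ih)) ix.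
  pose e (o : option T) := if o is Some i then h i else x.
  have ie : indep L e by apply: indep_map_inv; apply: eq_indep ix => -[].
  have /imsetP[i //] : None \in (Some @: [set: T])%SET.
  by apply: ie; rewrite -span_comp spanT.
have [x <-] := map_surj x'; move=> ghx; exists x => //; apply: contrapT.
move=> /(indep_ext Hex ih)/indep_map ix.
have /imsetP[i //] : None \in (Some @: [set: T])%SET.
by apply: ix; rewrite -span_comp spanT.
Qed.

(** Lines are the closures of pairs of distinct points, so [map_closure] carries lines to lines. *)
Lemma map_collineation : collineation L L' g.
Proof.
split.
  have /choice[g' gg'] := map_surj.
  by exists g' => // p; apply: map_inj; exact: gg'.
have line p q l l' : L l -> l p -> l q -> p <> q -> L' l' -> l' (g p) -> l' (g q) ->
    g @` l = l'.
  move=> Ll lp lq pq Ll' lp' lq'.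
  rewrite -(line_pair HL Ll lp lq pq) map_closure; last exact: (indep_pair Hex).
  have gpq : g p <> g q by move/map_inj.
  rewrite -(line_pair HL' Ll' lp' lq' gpq).
  by have -> : g \o two_points p q = two_points (g p) (g q) by apply/funext => -[].
have [_ two_pts join] := HL; have [_ two_pts' join'] := HL'.
apply/seteqP; split=> [_ [l Ll <-]|l' Ll'].
  have [p [q [lp lq pq]]] := two_pts _ Ll.
  have [|l' [Ll' lp' lq' _]] := join' (g p) (g q); first by move/map_inj.
  by rewrite (line p q l l').
have [p' [q' []]] := two_pts' _ Ll'.
have [p <-] := map_surj p'; have [q <-] := map_surj q' => lp' lq' gpq.
have pq : p <> q by move=> pq; apply: gpq; rewrite pq.
have [l [Ll lp lq _]] := join _ _ pq.
by exists l => //; exact: (line p q l l').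
Qed.

(** Independent points spanning [S] extend to a frame, and on the spans of that frame [f] is given
    by the matched one. *)
Lemma map_Grass S : Grass L k S -> f S = g @` S.
Proof.
move=> /is_dim_indep[h [ih <-]]; rewrite map_closure//.
have [H [s [iH s_inj Hs]]] := indep_frame Hex Hdim ih.
have [H' mH] := matched_left iH; have [_ _ HE] := mH.
have hE : h = H \o s by apply/funext => i; rewrite Hs.
have ghE : g \o h = H' \o s by apply/funext => i /=; rewrite (gE mH) hE.
rewrite ghE hE -(spanT L (H \o s)) -(spanT L' (H' \o s)).
rewrite (span_comp L H) (span_comp L' H') HE//.
by rewrite card_imset// cardsT card_ord.
Qed.

End PointMap.
End Main.

Theorem theorem2p4 (P P' : Type) (L : set (set P)) (L' : set (set P'))
  (n k : nat)
  (HL : linear_space L) (HL' : linear_space L')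
  (Hdim : is_dim L n setT) (Hdim' : is_dim L' n setT)
  (Hex : exchange_axiom L) (Hex' : exchange_axiom L')
  (HP2 : axiom_P2 L) (HP2' : axiom_P2 L')
  (Hn : 4 <= n) (Hnk : 2 * k + 1 < n)
  (f : set P -> set P')
  (Hbij : set_bij (Grass L k) (Grass L' k) f)
  (Hf : forall B, base L B ->
     exists B', base L' B' /\ f @` base_subset L k B = base_subset L' k B')
  (Hfinv : forall B', base L' B' ->
     exists B, base L B /\
       [set S | Grass L k S /\ base_subset L' k B' (f S)] = base_subset L k B) :
  exists g : P -> P', collineation L L' g /\
    forall S, Grass L k S -> f S = g @` S.
Proof.
have [g gE] := point_map HL Hdim Hdim' Hex Hex' HP2 Hnk Hbij Hf.
exists g; split.
  exact: (map_collineation HL HL' Hdim Hdim' Hex Hex' HP2 Hnk Hbij Hf Hfinv gE).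
exact: (map_Grass HL Hdim Hdim' Hex Hex' HP2 Hnk Hbij Hf Hfinv gE).
Qed.
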